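(* Let $\Bbbk$ be an algebraically closed field (of arbitrary characteristic), let $H$ be an affine Hopf algebra over $\Bbbk$ and let $C$ be a central Hopf subalgebra of $H$ such that $H$ is a finitely generated $C$-module. Let $$\mathcal{I}=\{\mathfrak{m}\in\mathrm{maxSpec}\,C\mid H/\mathfrak{m}H\text{ has a }1\text{-dimensional module}\},$$ a subgroup of $\mathrm{maxSpec}\,C$ under convolution. Then for any maximal ideal $\mathfrak{m}$ of $C$, the left coset $\mathfrak{m}\ast\mathcal{I}$ of $\mathcal{I}$ in $\mathrm{maxSpec}\,C$ containing $\mathfrak{m}$ coincides with the orbit $W_r(G(H^\circ))(\mathfrak{m})$ of $\mathfrak{m}$ under the action of the right winding automorphism group.
   Context: Affine means finitely generated as an algebra. $\mathrm{maxSpec}\,C$ is a group under the convolution product: the map $\chi\mapsto\mathfrak{m}_\chi=\mathrm{Ker}\,\chi$ is a bijection from the group $G(C^\circ)$ of characters (algebra maps $C\to\Bbbk$) to $\mathrm{maxSpec}\,C$, and $\mathfrak{m}_\chi\ast\mathfrak{m}_\psi=\mathfrak{m}_{\chi\ast\psi}$, where $(\chi\ast\psi)(c)=\sum\chi(c_{(1)})\psi(c_{(2)})$. $G(H^\circ)$ is the group of characters of $H$. For $\chi\in G(H^\circ)$ the right winding automorphism of $H$ is $W_r(\chi)(h)=\sum h_{(1)}\chi(h_{(2)})$; it preserves $C$ and so acts on $\mathrm{maxSpec}\,C$ by $\mathfrak{m}\mapsto W_r(\chi)(\mathfrak{m})$. The right winding automorphism group is $W_r(G(H^\circ))=\{W_r(\chi)\mid\chi\in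 G(H^\circ)\}$. *)

(* Defs.v *)
From HB Require Import structures.
From mathcomp Require Import all_boot all_order all_algebra.
From mathcomp Require Import generic_quotient ring_quotient.
From mathcomp Require Import all_classical.

Set Implicit Arguments.
Unset Strict Implicit.
Unset Printing Implicit Defensive.

Import GRing.Theory.
Local Open Scope ring_scope.
Local Open Scope quotient_scope.
Local Open Scope classical_set_scope.

(* The list [:: (v1, w1); ..; (vn, wn)] stands for the formal sum of the
   v_i (x) w_i. No separate coefficients are needed, as c (v (x) w) is
   (c v) (x) w. *)
Inductive tensor_eq (k : fieldType) (V W : lmodType k) :
    seq (V * W) -> seq (V * W) -> Prop :=
| TensRefl s : tensor_eq s s
| TensSym s t : tensor_eq s t -> tensor_eq t s
| TensTrans s t u : tensor_eq s t -> tensor_eq t u -> tensor_eq s u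
| TensCat s s' t t' :
    tensor_eq s s' -> tensor_eq t t' -> tensor_eq (s ++ t) (s' ++ t')
| TensC s t : tensor_eq (s ++ t) (t ++ s)
| Tens0 w : tensor_eq [:: (0, w)] [::]
| TensDl v v' w : tensor_eq [:: (v + v', w)] [:: (v, w); (v', w)]
| TensDr v w w' : tensor_eq [:: (v, w + w')] [:: (v, w); (v, w')]
| TensZ (c : k) v w : tensor_eq [:: (c *: v, w)] [:: (v, c *: w)].

Section Tensor.
Variables (k : fieldType) (V W : lmodType k).

Definition tensor_rel : rel (seq (V * W)) := fun s t => `[< tensor_eq s t >].

Lemma tensor_rel_equiv : equiv_class_of tensor_rel.
Proof.
split=> [s|s t|t s u]; first by apply/asboolP; exact: TensRefl.
  by apply/asboolP/asboolP; exact: TensSym.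
by move=> /asboolP st /asboolP tu; apply/asboolP; exact: TensTrans st tu.
Qed.

Canonical tensor_equiv_rel := EquivRelPack tensor_rel_equiv.

Definition tensor := {eq_quot tensor_equiv_rel}.

HB.instance Definition _ := Choice.on tensor.
HB.instance Definition _ := EqQuotient.on tensor.

Lemma tensor_eqP (s t : seq (V * W)) :
  (\pi_tensor s = \pi_tensor t) <-> tensor_eq s t.
Proof. by split=> [/eqquotP/asboolP//|st]; apply/eqquotP/asboolP. Qed.

Lemma tensor_repr (s : seq (V * W)) : tensor_eq (repr (\pi_tensor s)) s.
Proof. by apply/tensor_eqP; rewrite reprK. Qed.

Definition tens (v : V) (w : W) : tensor := \pi_tensor [:: (v, w)].

Definition tens_scale (c : k) (s : seq (V * W)) : seq (V * W) :=
  [seq (c *: p.1, p.2) | p <- s].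

Lemma tens_scale_eq c s t :
  tensor_eq s t -> tensor_eq (tens_scale c s) (tens_scale c t).
Proof.
rewrite /tens_scale; elim=> {s t} /=.
- by move=> s; exact: TensRefl.
- by move=> s t _; exact: TensSym.
- by move=> s t u _ st _; exact: TensTrans st.
- by move=> s s' t t' _ h1 _ h2; rewrite !map_cat; exact: TensCat.
- by move=> s t; rewrite !map_cat; exact: TensC.
- by move=> w; rewrite scaler0; exact: Tens0.
- by move=> v v' w; rewrite scalerDr; exact: TensDl.
- by move=> v w w'; exact: TensDr.
- by move=> d v w; rewrite scalerA mulrC -scalerA; exact: TensZ.
Qed.

Definition tensor_add (x y : tensor) : tensor := \pi_tensor (repr x ++ repr y).
Definition tensor_scale (c : k) (x : tensor) : tensor :=
  \pi_tensor (tens_scale c (repr x)).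
Definition tensor_zero : tensor := \pi_tensor [::].
Definition tensor_opp (x : tensor) : tensor := tensor_scale (-1) x.

Lemma tensor_addE s t :
  tensor_add (\pi_tensor s) (\pi_tensor t) = \pi_tensor (s ++ t).
Proof. by apply/tensor_eqP; apply: TensCat; exact: tensor_repr. Qed.

Lemma tensor_scaleE c s :
  tensor_scale c (\pi_tensor s) = \pi_tensor (tens_scale c s).
Proof. by apply/tensor_eqP/tens_scale_eq/tensor_repr. Qed.

Lemma tensor_addA : associative tensor_add.
Proof.
by move=> x y z; elim/quotW: x => s; elim/quotW: y => t; elim/quotW: z => u;
   rewrite (tensor_addE t u) (tensor_addE s t) !tensor_addE catA.
Qed.

Lemma tensor_addC : commutative tensor_add.
Proof.
move=> x y; elim/quotW: x => s; elim/quotW: y => t; rewrite !tensor_addE.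
by apply/tensor_eqP; exact: TensC.
Qed.

Lemma tensor_add0 : left_id tensor_zero tensor_add.
Proof. by move=> x; elim/quotW: x => s; rewrite tensor_addE. Qed.

Lemma tens_scale_cancel c d s : c + d = 0 ->
  tensor_eq (tens_scale c s ++ tens_scale d s) [::].
Proof.
move=> cd; elim: s => [|[v w] s IHs] /=; first exact: TensRefl.
apply: (@TensTrans _ _ _ _
  ([:: (c *: v, w); (d *: v, w)] ++ (tens_scale c s ++ tens_scale d s))).
  rewrite -[X in tensor_eq X _]/([:: (c *: v, w)] ++
    (tens_scale c s ++ ([:: (d *: v, w)] ++ tens_scale d s))).
  rewrite -[[:: _; _]]/([:: (c *: v, w)] ++ [:: (d *: v, w)]) -[X in tensor_eq _ X]catA.
  apply: TensCat; first exact: TensRefl.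
  by rewrite !catA; apply: TensCat; [exact: TensC | exact: TensRefl].
apply: (@TensCat _ _ _ [:: _; _] [::] _ [::] _ IHs).
apply: (@TensTrans _ _ _ _ [:: (0, w)]); last exact: Tens0.
apply: TensSym.
by rewrite -(scale0r v) -cd scalerDl; exact: TensDl.
Qed.

Lemma tens_scale1 s : tens_scale 1 s = s.
Proof.
by rewrite /tens_scale -[RHS]map_id; apply: eq_map => -[v w] /=; rewrite scale1r.
Qed.

Lemma tens_scale_comp c d s :
  tens_scale c (tens_scale d s) = tens_scale (c * d) s.
Proof.
by rewrite /tens_scale -map_comp; apply: eq_map => -[v w] /=; rewrite scalerA.
Qed.

Lemma tensor_addN : left_inverse tensor_zero tensor_opp tensor_add.
Proof.
move=> x; elim/quotW: x => s; rewrite /tensor_opp tensor_scaleE tensor_addE.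
apply/tensor_eqP; rewrite -[X in _ ++ X]tens_scale1.
by apply: tens_scale_cancel; rewrite addNr.
Qed.

HB.instance Definition _ := GRing.isZmodule.Build tensor
  tensor_addA tensor_addC tensor_add0 tensor_addN.

Lemma tensor_scaleA c d x :
  tensor_scale c (tensor_scale d x) = tensor_scale (c * d) x.
Proof.
elim/quotW: x => s.
by rewrite (tensor_scaleE d s) !tensor_scaleE tens_scale_comp.
Qed.

Lemma tensor_scale1 : left_id 1 tensor_scale.
Proof. by move=> x; elim/quotW: x => s; rewrite tensor_scaleE tens_scale1. Qed.

Lemma tensor_scaleDr : right_distributive tensor_scale +%R.
Proof.
move=> c x y; elim/quotW: x => s; elim/quotW: y => t.
rewrite -[_ + _]/(tensor_add _ _) -[RHS]/(tensor_add _ _).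
by rewrite tensor_addE !tensor_scaleE tensor_addE /tens_scale map_cat.
Qed.

Lemma tensor_scaleDl x : {morph tensor_scale^~ x : c d / c + d}.
Proof.
move=> c d; elim/quotW: x => s.
rewrite -[RHS]/(tensor_add _ _) !tensor_scaleE tensor_addE.
apply/tensor_eqP; elim: s => [|[v w] s IHs] /=; first exact: TensRefl.
apply: (@TensTrans _ _ _ _
  ([:: (c *: v, w); (d *: v, w)] ++ (tens_scale c s ++ tens_scale d s))).
  rewrite -cat1s; apply: TensCat IHs.
  by rewrite scalerDl; exact: TensDl.
rewrite -[X in tensor_eq _ X]/([:: (c *: v, w)] ++
  (tens_scale c s ++ ([:: (d *: v, w)] ++ tens_scale d s))).
rewrite -[[:: _; _]]/([:: (c *: v, w)] ++ [:: (d *: v, w)]) -[X in tensor_eq X _]catA.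
apply: TensCat; first exact: TensRefl.
by rewrite !catA; apply: TensCat; [exact: TensC | exact: TensRefl].
Qed.

HB.instance Definition _ := GRing.Zmodule_isLmodule.Build k tensor
  tensor_scaleA tensor_scale1 tensor_scaleDr tensor_scaleDl.

Lemma tensDl v v' w : tens (v + v') w = tens v w + tens v' w.
Proof.
by rewrite -[RHS]/(tensor_add _ _) tensor_addE; apply/tensor_eqP; exact: TensDl.
Qed.

Lemma tensDr v w w' : tens v (w + w') = tens v w + tens v w'.
Proof.
by rewrite -[RHS]/(tensor_add _ _) tensor_addE; apply/tensor_eqP; exact: TensDr.
Qed.

Lemma tensZl c v w : tens (c *: v) w = c *: tens v w.
Proof. by rewrite -[RHS]/(tensor_scale _ _) tensor_scaleE. Qed.

Lemma tensZr c v w : tens v (c *: w) = c *: tens v w.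
Proof. by rewrite -tensZl; apply/tensor_eqP/TensSym/TensZ. Qed.

Lemma tensor_piE s : \pi_tensor s = \sum_(p <- s) tens p.1 p.2.
Proof.
elim: s => [|[v w] s IHs]; first by rewrite big_nil.
by rewrite big_cons -IHs -[RHS]/(tensor_add _ _) tensor_addE.
Qed.

(* For x = \sum_i v_i (x) w_i, [tsum f x] is \sum_i f v_i w_i, computed on a
   chosen expression of x; it is independent of that expression when f is
   bilinear (lemma tsum_pi), the only case in which it is used below. *)
Definition tsum (U : lmodType k) (f : V -> W -> U) (x : tensor) : U :=
  \sum_(p <- repr x) f p.1 p.2.

Definition bilinear_map (U : lmodType k) (f : V -> W -> U) : Prop :=
  (forall w, linear (f^~ w)) /\ (forall v, linear (f v)).

Section Universal.
Variables (U : lmodType k) (f : V -> W -> U) (fB : bilinear_map f).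

Lemma tsum_pi s : tsum f (\pi_tensor s) = \sum_(p <- s) f p.1 p.2.
Proof.
have [fl fr] := fB.
have fD v v' w : f (v + v') w = f v w + f v' w.
  by have := fl w 1 v v'; rewrite /= !scale1r.
have fD' v w w' : f v (w + w') = f v w + f v w'.
  by have := fr v 1 w w'; rewrite /= !scale1r.
have f0 w : f 0 w = 0.
  by apply: (@addrI _ (f 0 w)); rewrite -fD !addr0.
have f0' v : f v 0 = 0.
  by apply: (@addrI _ (f v 0)); rewrite -fD' !addr0.
have fZ c v w : f (c *: v) w = c *: f v w.
  by have := fl w c v 0; rewrite /= !addr0 f0 addr0.
have fZ' c v w : f v (c *: w) = c *: f v w.
  by have := fr v c w 0; rewrite /= !addr0 f0' addr0.
suff sumE t u : tensor_eq t u ->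
    \sum_(p <- t) f p.1 p.2 = \sum_(p <- u) f p.1 p.2.
  by apply: sumE; exact: tensor_repr.
elim=> {t u} //.
- by move=> ? ? ? _ -> _ ->.
- by move=> ? ? ? ? _ e _ e'; rewrite !big_cat /= e e'.
- by move=> ? ?; rewrite !big_cat /= addrC.
- by move=> w; rewrite big_cons big_nil f0 addr0.
- by move=> v v' w; rewrite !big_cons !big_nil /= !addr0 fD.
- by move=> v w w'; rewrite !big_cons !big_nil /= !addr0 fD'.
- by move=> c v w; rewrite !big_cons !big_nil /= fZ fZ'.
Qed.

Lemma tsum_tens v w : tsum f (tens v w) = f v w.
Proof. by rewrite tsum_pi big_cons big_nil addr0. Qed.

Lemma tsum_linear : linear (tsum f).
Proof.
move=> c x y; elim/quotW: x => s; elim/quotW: y => t.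
rewrite -[c *: _ + _]/(tensor_add (tensor_scale _ _) _) tensor_scaleE.
rewrite tensor_addE !tsum_pi big_cat big_map scaler_sumr; congr (_ + _).
have [fl _] := fB; apply: eq_bigr => -[v w] _ /=.
have f0 : f 0 w = 0.
  apply: (@addrI _ (f 0 w)); have := fl w 1 0 0.
  by rewrite /= !scale1r !addr0.
by have := fl w c v 0; rewrite /= !addr0 f0 addr0.
Qed.

End Universal.
End Tensor.

Notation "v ⊗ w" := (tens v w) (at level 40, left associativity) : ring_scope.

Section TensorMul.
Variables (k : fieldType) (A B : algType k).

Definition tensor_mul (x y : tensor A B) : tensor A B :=
  tsum (fun a b => tsum (fun a' b' => (a * a') ⊗ (b * b')) y) x.

End TensorMul.

HB.mixin Record Algebra_isHopf (k : fieldType) H of GRing.Algebra k H := {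
  comul : {linear H -> tensor H H};
  counit : {lrmorphism H -> k^o};
  antipode : {linear H -> H};
  comulA : forall h,
    tsum (fun a b => tsum (fun a1 a2 => a1 ⊗ a2 ⊗ b) (comul a)) (comul h) =
    tsum (fun a b => tsum (fun b1 b2 => a ⊗ b1 ⊗ b2) (comul b)) (comul h);
  counitl : forall h, tsum (fun a b => counit a *: b) (comul h) = h;
  counitr : forall h, tsum (fun a b => counit b *: a) (comul h) = h;
  comul1 : comul 1 = 1 ⊗ 1;
  comulM : forall g h, comul (g * h) = tensor_mul (comul g) (comul h);
  antipodel : forall h,
    tsum (fun a b => antipode a * b) (comul h) = (counit h)%:A;
  antipoder : forall h,
    tsum (fun a b => a * antipode b) (comul h) = (counit h)%:A
}.

#[short(type="hopfAlgType")]
HB.structure Definition Hopf (k : fieldType) :=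
  {H of Algebra_isHopf k H & GRing.Algebra k H}.

Definition affine (k : fieldType) (A : algType k) : Prop :=
  exists s : seq A, forall P : {pred A},
    GRing.subalg_closed P -> {subset s <= P} -> forall a, a \in P.

(* A Hopf subalgebra is given as a Hopf algebra with an injective Hopf algebra
   map [incl] to H. *)
Record centralHopfSubalg (k : fieldType) (H : hopfAlgType k) := {
  hsub_sort :> hopfAlgType k;
  incl : {lrmorphism hsub_sort -> H};
  incl_inj : injective incl;
  incl_comul : forall c,
    comul (incl c) = tsum (fun a b => incl a ⊗ incl b) (comul c);
  incl_counit : forall c, counit (incl c) = counit c;
  incl_antipode : forall c, antipode (incl c) = incl (antipode c);
  incl_central : forall c h, incl c * h = h * incl c
}.

Arguments incl {k H _}.

Definition finite_over (k : fieldType) (H : hopfAlgType k)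
    (C : centralHopfSubalg H) : Prop :=
  exists s : seq H, forall h : H, exists c : 'I_(size s) -> C,
    h = \sum_i incl (c i) * s`_i.

Definition is_ideal (A : nzRingType) (J : set A) : Prop :=
  [/\ J 0, forall x y, J x -> J y -> J (x + y),
      forall a x, J x -> J (a * x) & forall x a, J x -> J (x * a)].

Record ideal (A : nzRingType) := {
  ideal_set :> A -> Prop;
  idealP : is_ideal ideal_set
}.

Definition maxSpec (A : nzRingType) : set (set A) :=
  [set m | [/\ is_ideal m, ~ m 1 &
    forall J, is_ideal J -> m `<=` J -> J = m \/ J = setT]].

Section IdealQuotient.
Variables (A : nzRingType) (J : ideal A).

Definition ideal_pred : {pred A} := fun x => `[< J x >].

Lemma ideal_predP x : reflect (J x) (x \in ideal_pred).
Proof. exact: asboolP. Qed.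

Lemma ideal_zmod_closed : zmod_closed ideal_pred.
Proof.
have [J0 JD JM _] := idealP J.
split=> [|x y /ideal_predP Jx /ideal_predP Jy]; apply/ideal_predP=> //.
by apply: JD => //; rewrite -mulN1r; exact: JM.
Qed.

HB.instance Definition _ := GRing.isZmodClosed.Build A ideal_pred
  ideal_zmod_closed.

Definition ideal_quot := Quotient.quot ideal_pred.

HB.instance Definition _ := GRing.Zmodule.on ideal_quot.
HB.instance Definition _ := EqQuotient.on ideal_quot.

Lemma ideal_quotP x y : \pi_ideal_quot x = \pi_ideal_quot y <-> J (x - y).
Proof.
split=> [/eqP|Jxy]; last by apply/eqP; rewrite -Quotient.idealrBE; apply/ideal_predP.
by rewrite -Quotient.idealrBE => /ideal_predP.
Qed.

Definition quot_one : ideal_quot := \pi_ideal_quot 1.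
Definition quot_mul (x y : ideal_quot) : ideal_quot :=
  \pi_ideal_quot (repr x * repr y).

Lemma quot_mulE x y :
  quot_mul (\pi_ideal_quot x) (\pi_ideal_quot y) = \pi_ideal_quot (x * y).
Proof.
have [_ JD JMl JMr] := idealP J; apply/ideal_quotP.
set x' := repr _; set y' := repr _.
have Jx : J (x' - x) by apply/ideal_quotP; rewrite reprK.
have Jy : J (y' - y) by apply/ideal_quotP; rewrite reprK.
have -> : x' * y' - x * y = (x' - x) * y' + x * (y' - y).
  by rewrite mulrBl mulrBr addrA subrK.
by apply: JD; [exact: JMr | exact: JMl].
Qed.

Lemma quot_addE x y :
  \pi_ideal_quot x + \pi_ideal_quot y = \pi_ideal_quot (x + y).
Proof. by rewrite -pi_addr. Qed.

Lemma quot_mulA : associative quot_mul.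
Proof.
by move=> x y z; elim/quotW: x => x; elim/quotW: y => y; elim/quotW: z => z;
   rewrite (quot_mulE y z) (quot_mulE x y) !quot_mulE mulrA.
Qed.

Lemma quot_mul1 : left_id quot_one quot_mul.
Proof. by move=> x; elim/quotW: x => x; rewrite quot_mulE mul1r. Qed.

Lemma quot_1mul : right_id quot_one quot_mul.
Proof. by move=> x; elim/quotW: x => x; rewrite quot_mulE mulr1. Qed.

Lemma quot_mulDl : left_distributive quot_mul +%R.
Proof.
move=> x y z; elim/quotW: x => x; elim/quotW: y => y; elim/quotW: z => z.
by rewrite (quot_addE x y) !quot_mulE quot_addE mulrDl.
Qed.

Lemma quot_mulDr : right_distributive quot_mul +%R.
Proof.
move=> x y z; elim/quotW: x => x; elim/quotW: y => y; elim/quotW: z => z.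
by rewrite (quot_addE y z) !quot_mulE quot_addE mulrDr.
Qed.

(* Possibly the zero ring, hence a pzRingType. *)
HB.instance Definition _ := GRing.Zmodule_isPzRing.Build ideal_quot
  quot_mulA quot_mul1 quot_1mul quot_mulDl quot_mulDr.

End IdealQuotient.

Definition character (k : fieldType) (A : algType k) := {lrmorphism A -> k^o}.

Definition char_ker (k : fieldType) (A : algType k) (chi : character A) :
  set A := [set a | chi a = 0].

Section Winding.
Variables (k : fieldType) (H : hopfAlgType k).

Definition conv (chi psi : character H) (h : H) : k^o :=
  tsum (fun a b => chi a * psi b : k^o) (comul h).

(* The convolution Ker(chi) * Ker(psi) = Ker(chi * psi); chi and psi are
   determined by their kernels. If m or n is not the kernel of a character,
   the value is the empty set, which is not a maximal ideal. *)
Definition mconv (m n : set H) : set H :=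
  [set h | exists chi psi : character H,
    [/\ m = char_ker chi, n = char_ker psi & conv chi psi h = 0]].

Definition conv_subgroup (X : set (set H)) : Prop :=
  [/\ X `<=` @maxSpec H, X (char_ker (@counit k H)),
      forall m n, X m -> X n -> X (mconv m n) &
      forall m, X m -> exists2 n, X n &
        mconv m n = char_ker (@counit k H) /\
        mconv n m = char_ker (@counit k H)].

Definition winding_r (chi : character H) (h : H) : H :=
  tsum (fun a b => chi b *: a) (comul h).

Definition winding_r_group : set (H -> H) := range winding_r.

End Winding.

Arguments winding_r_group {k} H.

Section CentralSubalgebra.
Variables (k : fieldType) (H : hopfAlgType k) (C : centralHopfSubalg H).

Definition ext_set (m : set C) : set H :=
  [set h | exists2 s : seq (C * H), (forall p, p \in s -> m p.1) &
    h = \sum_(p <- s) incl p.1 * p.2].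

Lemma ext_set_ideal m : is_ideal (ext_set m).
Proof.
split.
- by exists [::]; rewrite ?big_nil.
- move=> _ _ [s ms ->] [t mt ->]; exists (s ++ t); rewrite ?big_cat // => p.
  by rewrite mem_cat => /orP[/ms|/mt].
- move=> a _ [s ms ->]; exists [seq (p.1, a * p.2) | p <- s].
    by move=> _ /mapP[p /ms ? ->].
  rewrite big_map mulr_sumr; apply: eq_bigr => p _ /=.
  by rewrite !mulrA incl_central.
- move=> _ a [s ms ->]; exists [seq (p.1, p.2 * a) | p <- s].
    by move=> _ /mapP[p /ms ? ->].
  by rewrite big_map mulr_suml; apply: eq_bigr => p _ /=; rewrite mulrA.
Qed.

(* mH, two-sided because C is central. *)
Definition ext_ideal (m : set C) : ideal H := Build_ideal (ext_set_ideal m).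

(* M is a module over H/mH spanned over k by one nonzero vector; the scalar c
   acts on M as the class of c 1_H. *)
Definition has_dim1_module (m : set C) : Prop :=
  exists (M : lmodType (ideal_quot (ext_ideal m))) (v : M),
    v != 0 /\
    forall w : M, exists c : k, w = \pi_(ideal_quot (ext_ideal m)) c%:A *: v.

Definition dim1_locus : set (set C) :=
  [set m | maxSpec m /\ has_dim1_module m].

Definition left_coset (m : set C) (X : set (set C)) : set (set C) :=
  [set mconv m n | n in X].

(* A map f : H -> H preserving C acts on subsets m of C; elements of C are
   compared inside H. *)
Definition restr_act (f : H -> H) (m : set C) : set C :=
  [set c | exists2 d, m d & incl c = f (incl d)].

Definition orbit_of (G : set (H -> H)) (m : set C) : set (set C) :=
  [set restr_act f m | f in G].

End CentralSubalgebra.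

Arguments dim1_locus {k H} C.

(* Main.v *)
Require Import Defs.
From mathcomp Require Import all_boot all_order all_algebra.
From mathcomp Require Import generic_quotient ring_quotient.
From mathcomp Require Import all_classical.
From HB Require Import structures.

(** Everything is read off from characters, because every maximal ideal in
sight is the kernel of one.

The locus I consists of the kernels of the restrictions to C of characters of
H ([dim1_locusP]). On a one-dimensional module over H/mH the algebra H acts
through a character, whose restriction to C kills m and so, by maximality of m,
has kernel m; conversely a character of H killing m makes k such a module.

The characters of H form a group under convolution ([conv_char], [char_inv])
and restriction to C is multiplicative ([res_conv]); hence I is a subgroup.

For a character phi of C and a character chi of H with convolution inverse
chi', the winding automorphism of chi' inverts that of chi and restricts to C.
Hence c lies in the image of Ker phi under the winding automorphism of chi
exactly when phi kills the image of c under that of chi', and that value of phi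
is (phi * chi')(c). So W_r(chi)(Ker phi) = Ker(phi * chi'),
with chi' restricted to C ([restr_act_wind]), and as chi runs through the group of characters of H so
does chi', which identifies the orbit of Ker phi with its coset.

What remains is that a maximal ideal m of C is the kernel of a character
([maxSpec_char_ker]): the Nullstellensatz for C. Put K = C/m. By Nakayama's
argument the K-algebra H/mH is nonzero ([nakayama]); it is finite over K and
finitely generated over k, so by the argument of Artin and Tate K is finitely
generated as a k-algebra ([artin_tate]). Finally a domain that is finitely
generated over an algebraically closed field k has a k-algebra map to k
([finite_type_retraction]); composing it with the projection from C gives a
character that kills m. *)

Set Implicit Arguments.
Unset Strict Implicit.
Unset Printing Implicit Defensive.

Import GRing.Theory.
Local Open Scope ring_scope.
Local Open Scope quotient_scope.
Local Open Scope classical_set_scope.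

(** * Points of finitely generated algebras over an algebraically closed field *)

Section PseudoGenerator.
Variables (R : comNzRingType) (K : idomainType) (j : {rmorphism R -> K}).

(** The map j need not be injective, so the leading coefficient of f may be
killed; dropping the killed top coefficients repairs this. *)
Lemma trim_poly (f : {poly R}) : map_poly j f != 0 ->
  exists g, [/\ map_poly j g = map_poly j f, (size g <= size f)%N
              & j (lead_coef g) != 0].
Proof.
move=> nz; pose n := size (map_poly j f).
have ngt0 : (0 < n)%N by rewrite size_poly_gt0.
have cn : j f`_n.-1 != 0 by rewrite -coef_map -/(lead_coef _) lead_coef_eq0.
have szg : size (take_poly n f) = n.
  apply/eqP; rewrite eqn_leq size_take_poly /= -(prednK ngt0) ltnNge.
  apply: contra cn => /leq_sizeP/(_ _ (leqnn _)).
  rewrite coef_take_poly prednK // leqnn => ->; by rewrite rmorph0.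
exists (take_poly n f); split.
- apply/polyP=> i; rewrite !coef_map coef_take_poly; case: ltnP => // le_ni.
  by rewrite raddf0 -coef_map nth_default.
- by rewrite szg size_poly.
- by rewrite lead_coefE szg coef_take_poly prednK // leqnn.
Qed.

(** J plays the part of an ideal of R[X] containing the kernel of the map on
coefficients. As R is not a field, an element of least degree divides the others
only up to a power of its leading coefficient (pseudo-division); that j does not
kill this coefficient is what makes the relation usable. *)
Lemma pseudo_generator (J : {poly R} -> Prop) :
    (forall a f s g, J f -> J g -> J (a *: f - s * g)) ->
    (forall f, map_poly j f = 0 -> J f) ->
    (exists2 f, J f & map_poly j f != 0) ->
  exists g, [/\ J g, j (lead_coef g) != 0 &
    forall f, J f -> exists n s,
      map_poly j (lead_coef g ^+ n *: f) = map_poly j (s * g)].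
Proof.
move=> JB Jker [f0 Jf0 f0nz].
have trimJ f : J f -> map_poly j f != 0 ->
    exists g, [/\ J g, (size g <= size f)%N & j (lead_coef g) != 0].
  move=> Jf /trim_poly[g [gf szg nzg]]; exists g; split=> //.
  rewrite -[g](subKr f) -[X in X - _]scale1r -[X in _ - X]mul1r.
  by apply: JB => //; apply: Jker; rewrite rmorphB /= gf subrr.
pose P n := `[< exists g, [/\ J g, size g = n & j (lead_coef g) != 0] >].
have exP : exists n, P n.
  have [g [Jg _ nzg]] := trimJ _ Jf0 f0nz.
  by exists (size g); apply/asboolP; exists g.
case: (ex_minnP exP) => n /asboolP[g [Jg szg nzg]] minP.
exists g; split=> // f Jf; exists (Pdiv.CommonRing.rscalp f g).
exists (Pdiv.CommonRing.rdivp f g).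
have eqf := Pdiv.ComRing.rdivp_eq g f.
set r := Pdiv.CommonRing.rmodp f g in eqf.
have Jr : J r.
  have -> : r = lead_coef g ^+ Pdiv.CommonRing.rscalp f g *: f
                - Pdiv.CommonRing.rdivp f g * g by rewrite eqf addrC addKr.
  exact: JB.
rewrite eqf rmorphD /=; have [->|rnz] := eqVneq (map_poly j r) 0.
  by rewrite addr0.
have [h [Jh szh nzh]] := trimJ _ Jr rnz.
have g0 : g != 0 by apply: contraNneq nzg => ->; rewrite lead_coef0 rmorph0.
have Ph : P (size h) by apply/asboolP; exists h.
have := minP _ Ph; rewrite leqNgt -szg.
by rewrite (leq_ltn_trans szh (Pdiv.CommonRing.ltn_rmodpN0 f g0)).
Qed.

End PseudoGenerator.

Section Extension.
Variables (k : closedFieldType) (K : idomainType).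

(** A nonzero element of the image of j survives under some k-valued point of
that image. The quantification over b is what allows adjoining one
generator at a time, since extending a character to a simple extension may
require finitely many elements to have nonzero value. *)
Definition separating (R : comNzRingType) (e : {rmorphism k -> R})
    (j : {rmorphism R -> K}) : Prop :=
  forall b, j b != 0 -> exists phi : {rmorphism R -> k},
    [/\ forall c, phi (e c) = c, forall r, j r = 0 -> phi r = 0 & phi b != 0].

Section Adjunction.
Variables (R : comNzRingType) (e : {rmorphism k -> R}).
Variables (j : {rmorphism R -> K}) (j' : {rmorphism {poly R} -> K}).
Hypothesis j'C : forall r, j' r%:P = j r.

Let j'E f : j' f = (map_poly j f).[j' 'X].
Proof.
elim/poly_ind: f => [|f c IHf]; first by rewrite !rmorph0 horner0.
by rewrite rmorphD rmorphM /= IHf j'C rmorphD rmorphM /= map_polyX map_polyC !hornerE.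
Qed.

Let map_eq0_kill (phi : {rmorphism R -> k}) f :
  (forall r, j r = 0 -> phi r = 0) -> map_poly j f = 0 -> map_poly phi f = 0.
Proof.
move=> kill jf0; apply/polyP=> i; rewrite coef_map coef0; apply: kill.
by have := coef_map j f i; rewrite jf0 coef0.
Qed.

(** A character phi of R is extended to R[X] by choosing the image xi of X. Let
x = j' X. If x is transcendental over j(R), any xi at which the image of q does
not vanish will do. If x is algebraic, let p generate the relations of x up to
powers of its leading coefficient a; then xi must be a root of phi(p), and
phi(a) <> 0 ensures both that there is such a root and that every relation of x
becomes one of xi. For q(x) not to be sent to 0, take c <> 0 in j(R) that is a
multiple of q(x), and start from phi with phi(c) <> 0. *)
Lemma separating_poly : separating e j -> separating (polyC \o e) j'.
Proof.
move=> sepR q jq.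
have mk (phi : {rmorphism R -> k}) xi : (forall c, phi (e c) = c) ->
    (forall f, j' f = 0 -> (map_poly phi f).[xi] = 0) ->
    (map_poly phi q).[xi] != 0 ->
    exists phi' : {rmorphism {poly R} -> k},
    [/\ forall c, phi' ((polyC \o e) c) = c, forall r, j' r = 0 -> phi' r = 0
      & phi' q != 0].
  move=> phie kill nz.
  exists (horner_eval xi \o map_poly phi); split=> // c.
  by rewrite /= map_polyC /horner_eval hornerC; exact: phie.
have [alg|transc] := pselect (exists2 f, j' f = 0 & map_poly j f != 0); last first.
  have kerj f : j' f = 0 -> map_poly j f = 0.
    by move=> jf; apply: contrapT => /eqP nz; apply: transc; exists f.
  have qnz : map_poly j q != 0.
    by apply: contraNneq jq => q0; rewrite j'E q0 horner0.
  have [phi [phie kill nz]] : exists phi : {rmorphism R -> k},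
    [/\ forall c, phi (e c) = c, forall r, j r = 0 -> phi r = 0
      & phi q`_(size (map_poly j q)).-1 != 0].
    by apply: sepR; rewrite -coef_map -/(lead_coef _) lead_coef_eq0.
  have /closed_nonrootP[xi nxi] : map_poly phi q != 0.
    by apply: contraNneq nz => q0; rewrite -coef_map q0 coef0.
  apply: (mk phi xi) => // f /kerj /map_eq0_kill-> //; exact: horner0.
have [p [jp ap genp]] : exists p, [/\ j' p = 0, j (lead_coef p) != 0 &
    forall f, j' f = 0 -> exists n s,
      map_poly j (lead_coef p ^+ n *: f) = map_poly j (s * p)].
  apply: (pseudo_generator (J := fun f => j' f = 0)) alg => [a f s g jf jg|f jf].
    by rewrite -mul_polyC rmorphB !rmorphM /= jf jg !mulr0 subrr.
  by rewrite j'E jf horner0.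
have apn n : j (lead_coef p ^+ n) != 0 by rewrite rmorphXn expf_neq0.
have mapE b f s g : map_poly j (b *: f) = map_poly j (s * g) ->
    j b *: map_poly j f = map_poly j s * map_poly j g.
  by rewrite map_polyZ rmorphM.
have pnz : map_poly j p != 0.
  apply: contraNneq ap => p0; rewrite lead_coefE.
  by have := coef_map j p (size p).-1; rewrite p0 coef0 => <-.
have minp s : j' s = 0 -> map_poly j s != 0 ->
    (size (map_poly j p) <= size (map_poly j s))%N.
  move=> js snz; have [n [t e1]] := genp _ js.
  have nz : map_poly j t * map_poly j p != 0.
    by rewrite -(mapE _ _ _ _ e1) scale_poly_eq0 negb_or apn.
  rewrite -(size_scale (map_poly j s) (apn n)) (mapE _ _ _ _ e1).
  move: nz; rewrite mulf_eq0 negb_or => /andP[tnz _].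
  by rewrite size_mul // -(prednK (_ : 0 < size (map_poly j t)))%N
     ?size_poly_gt0 // addSn leq_addl.
(* The polynomials whose value at x is a multiple of q(x) have a generator g.
   As p is among them, g divides p up to a power of its leading coefficient,
   and minimality of p forces g to be constant. *)
have [c [v [jc jcv]]] : exists c v, j c != 0 /\ j' (v * q) = j c.
  pose J f := exists v, j' f = j' (v * q).
  have [|||g [[v jg] ag geng]] := @pseudo_generator _ _ j J.
  - move=> b f s g [v jf] [w jg]; exists (b%:P * v - s * w).
    by rewrite -mul_polyC mulrBl -!mulrA !rmorphB !rmorphM /= jf jg !rmorphM.
  - by move=> f f0; exists 0; rewrite mul0r rmorph0 j'E f0 horner0.
  - by exists p => //; exists 0; rewrite mul0r rmorph0.
  have [n [s e1]] : exists n s, map_poly j (lead_coef g ^+ n *: p) = map_poly j (s * g).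
    by apply: geng; exists 0; rewrite mul0r rmorph0.
  have [n' [s' e2]] : exists n s, map_poly j (lead_coef g ^+ n *: q) = map_poly j (s * g).
    by apply: geng; exists 1; rewrite mul1r.
  have agn m : j (lead_coef g ^+ m) != 0 by rewrite rmorphXn expf_neq0.
  have gnz : j' g != 0.
    have : j' (lead_coef g ^+ n' *: q) != 0.
      by rewrite -mul_polyC rmorphM /= j'C mulf_neq0.
    by rewrite j'E e2 -j'E rmorphM mulf_eq0 negb_or => /andP[].
  have js : j' s = 0.
    apply: (mulIf gnz); rewrite mul0r -rmorphM j'E -e1 -j'E.
    by rewrite -mul_polyC rmorphM jp mulr0.
  have sgnz : map_poly j s * map_poly j g != 0.
    by rewrite -(mapE _ _ _ _ e1) scale_poly_eq0 negb_or agn.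
  have := sgnz; rewrite mulf_eq0 negb_or => /andP[snz gnz'].
  have szg : (size (map_poly j g) <= 1)%N.
    have := minp s js snz; rewrite -(size_scale (map_poly j p) (agn n)) (mapE _ _ _ _ e1).
    rewrite size_mul // -(prednK (_ : 0 < size (map_poly j s))%N) ?size_poly_gt0 //.
    by rewrite addSn /= -[X in (_ <= X)%N -> _]addn1 leq_add2l.
  exists g`_0, v; rewrite -jg.
  suff e3 : j' g = j g`_0 by rewrite -e3.
  by rewrite j'E (size1_polyC szg) hornerC coef_map.
have [phi [phie kill]] : exists phi : {rmorphism R -> k},
    [/\ forall c, phi (e c) = c, forall r, j r = 0 -> phi r = 0
      & phi (lead_coef p * c) != 0].
  by apply: sepR; rewrite rmorphM mulf_neq0.
rewrite rmorphM mulf_eq0 negb_or => /andP[nza nzc].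
have /closed_rootP[xi /rootP rxi] : size (map_poly phi p) != 1%N.
  rewrite size_map_poly_id0 //; apply: contra_neqN ap => /eqP sz1 //.
  have pC := size1_polyC (eq_leq sz1); apply/eqP.
  by rewrite lead_coefE sz1 -j'C -pC jp.
have kill' f : j' f = 0 -> (map_poly phi f).[xi] = 0.
  move=> jf; have [n [s e1]] := genp f jf.
  have : map_poly phi (lead_coef p ^+ n *: f - s * p) = 0.
    by apply: map_eq0_kill => //; rewrite rmorphB /= e1 subrr.
  rewrite -mul_polyC rmorphB !rmorphM /= map_polyC => /(congr1 (horner^~ xi)).
  rewrite !hornerE rxi mulr0 subr0 => /eqP.
  have nzn : phi (lead_coef p ^+ n) != 0 by rewrite rmorphXn expf_neq0.
  by rewrite mulf_eq0 => /orP[/(negP nzn)|/eqP].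
apply: (mk phi xi) => //; apply: contraNneq nzc => q0.
have := kill' (v * q - c%:P).
rewrite rmorphB /= jcv j'C subrr => /(_ erefl).
by rewrite rmorphB rmorphM /= map_polyC !hornerE q0 mulr0 sub0r => /eqP; rewrite oppr_eq0.
Qed.
End Adjunction.
End Extension.

Lemma rmorphism_of (A B : pzRingType) (f : A -> B) :
  zmod_morphism f -> monoid_morphism f ->
  exists g : {rmorphism A -> B}, g =1 f.
Proof.
move=> fB fM.
pose m1 := GRing.isZmodMorphism.Build A B f fB.
pose m2 := GRing.isMonoidMorphism.Build A B f fM.
pose g : {rmorphism A -> B} := HB.pack f m1 m2.
by exists g.
Qed.

(** Generation as an algebra over the image of iota, as an induction principle
over predicates, so that no type of subalgebras is needed. *)
Definition generates (k : Type) (A : pzRingType) (iota : k -> A) (s : seq A) :=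
  forall P : A -> Prop,
    (forall c, P (iota c)) -> (forall x y, P x -> P y -> P (x - y)) ->
    (forall x y, P x -> P y -> P (x * y)) -> (forall x, x \in s -> P x) ->
  forall x, P x.

Section ZariskiLemma.
Variables (k : closedFieldType) (K : idomainType) (iota : {rmorphism k -> K}).

(** R is an iterated polynomial ring over k, one variable for each entry of s. *)
Lemma separating_cover (s : seq K) :
  exists (R : comNzRingType) (e : {rmorphism k -> R}) (j : {rmorphism R -> K}),
    [/\ separating e j, forall c, j (e c) = iota c &
        forall x, x \in s -> exists r, j r = x].
Proof.
elim: s => [|x s [R [e [j [sep je cov]]]]].
  exists k, idfun, iota; split=> // b nz; exists idfun; split=> //.
    by move=> r /eqP; rewrite fmorph_eq0 => /eqP.
  by apply: contraNneq nz => /= ->; rewrite rmorph0.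
exists {poly R}, (polyC \o e), (horner_eval x \o map_poly j).
have jC r : (horner_eval x \o map_poly j) r%:P = j r.
  by rewrite /= map_polyC /horner_eval hornerC.
split=> [|c|y]; first exact: (separating_poly jC).
  by rewrite -je -jC.
rewrite inE => /predU1P[->|/cov[r <-]]; last first.
  by exists r%:P; exact: jC.
by exists 'X; rewrite /= map_polyX /horner_eval hornerX.
Qed.

(** The image of j is all of K, and a character of R killing the kernel of j
descends to it. *)
Lemma finite_type_retraction (s : seq K) : generates iota s ->
  exists psi : {rmorphism K -> k}, cancel iota psi.
Proof.
move=> gens; have [R [e [j [sep je cov]]]] := separating_cover s.
have surj : forall x, exists r, j r = x.
  apply: (gens (fun x => exists r, j r = x)) =>
      [c|_ _ [x <-] [y <-]|_ _ [x <-] [y <-]|//].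
  - by exists (e c); rewrite je.
  - by exists (x - y); rewrite rmorphB.
  - by exists (x * y); rewrite rmorphM.
have [|phi [phie kill _]] := sep 1; first by rewrite rmorph1 oner_neq0.
have [r rK] := choice surj.
have phiE x y : j x = j y -> phi x = phi y.
  by move=> exy; apply/eqP; rewrite -subr_eq0 -rmorphB kill // rmorphB exy subrr.
have [||psi psiE] := @rmorphism_of K k (phi \o r).
- by move=> x y /=; rewrite -rmorphB; apply: phiE; rewrite rmorphB !rK.
- by split=> [|x y] /=; rewrite -?rmorphM -1?[RHS](rmorph1 phi); apply: phiE;
     rewrite ?rmorph1 ?rmorphM !rK.
by exists psi => c; rewrite psiE /= -[RHS]phie; apply: phiE; rewrite rK je.
Qed.
End ZariskiLemma.

(** * The Artin-Tate argument over a field *)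

Section ArtinTate.
Variables (k : Type) (K : fieldType) (iota : k -> K) (D : pzRingType).
Variable g : {rmorphism K -> D}.
Hypothesis gC : forall c x, g c * x = x * g c.
Hypothesis D1 : 1 != 0 :> D.

(** Choose an independent spanning family e_i of D over K with e_0 = 1, and let P
be a subalgebra of K containing the coordinates of the generators of D and of
the products e_i e_l. The span of the e_i over P is a subalgebra containing the
generators, so it is D; comparing the e_0-coordinates of z 1, for z in K,
gives P = K. *)
Lemma artin_tate (N : nat) (d : 'I_N -> D) (t : seq D) :
    (forall x, exists c, x = \sum_i g (c i) * d i) -> generates (g \o iota) t ->
  exists s : seq K, generates iota s.
Proof.
move=> spand gent.
pose e (i : 'I_N.+1) := oapp d 1 (unlift ord0 i).
have e0 : e ord0 = 1 by rewrite /e unlift_none.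
(* Independence comes from minimality of a spanning subfamily, among those
   that keep e_0 = 1; once the other coefficients vanish, so does that of
   e_0, because 1 <> 0 in D. *)
pose spans (B : {set 'I_N.+1}) :=
  (ord0 \in B) && `[< forall x, exists c, x = \sum_(i in B) g (c i) * e i >].
have spT : spans [set: 'I_N.+1]%SET.
  rewrite /spans inE; apply/asboolP=> x; have [c ->] := spand x.
  exists (fun i => oapp c 0 (unlift ord0 i)).
  rewrite [RHS](eq_bigl xpredT) => [|i]; last by rewrite inE.
  rewrite big_ord_recl /= unlift_none /= rmorph0 mul0r add0r.
  by apply: eq_bigr => i _; rewrite /e liftK.
have [B spB minB] : exists2 B, spans B & forall B', spans B' -> (#|B| <= #|B'|)%N.
  by case: (arg_minnP (fun B : {set _} => #|B|) spT) => B; exists B.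
have /andP[B0 /asboolP spanB] := spB.
have freeB c : \sum_(i in B) g (c i) * e i = 0 -> c ord0 = 0.
  move=> c0; have cn i : i \in B -> i != ord0 -> c i = 0.
    move=> Bi i0; apply: contrapT => /eqP ci.
    suff /minB : spans (B :\ i) by rewrite [#|B|](cardsD1 i) Bi ltnn.
    rewrite /spans !inE eq_sym i0 B0 /=; apply/asboolP=> x.
    have [a ->] := spanB x; exists (fun l => a l - a i / c i * c l).
    rewrite -[LHS]subr0 -[X in _ - X](mulr0 (g (a i / c i))) -[X in _ - _ * X]c0.
    rewrite mulr_sumr -sumrB.
    rewrite (bigD1 i) //= mulrA -rmorphM divfK // subrr add0r.
    apply: eq_big => [l|l _]; first by rewrite !inE andbC.
    by rewrite mulrA -rmorphM -mulrBl -rmorphB.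
  move: c0; rewrite (bigD1 ord0) //= e0 mulr1 big1 => [|i /andP[Bi i0]].
    rewrite addr0 => gc; apply: contrapT => /eqP cnz; case/eqP: D1.
    by rewrite -(rmorph1 g) -(mulVf cnz) rmorphM gc mulr0.
  by rewrite cn // rmorph0 mul0r.
have [co coE] := choice spanB.
exists ([seq co x i | x <- t, i <- enum 'I_N.+1] ++
        [seq co (e p.1 * e p.2) i | p <- enum {: 'I_N.+1 * 'I_N.+1}, i <- enum 'I_N.+1]).
move=> P Pk PB PM Ps.
have Pt x i : x \in t -> P (co x i).
  move=> tx; apply: Ps; rewrite mem_cat; apply/orP; left.
  by apply/allpairsP; exists (x, i); rewrite /= mem_enum.
have Pe i l r : P (co (e i * e l) r).
  apply: Ps; rewrite mem_cat; apply/orP; right.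
  by apply/allpairsP; exists ((i, l), r); rewrite /= !mem_enum.
have P0 : P 0 by rewrite -(subrr (co (e ord0 * e ord0) ord0)); apply: PB; apply: Pe.
have PD x y : P x -> P y -> P (x + y).
  by move=> Px Py; rewrite -[y]opprK -[- y]sub0r; apply: (PB) => //; apply: PB.
pose Q x := exists c, (forall i, P (c i)) /\ x = \sum_(i in B) g (c i) * e i.
have QD x y : Q x -> Q y -> Q (x + y).
  move=> [a [Pa ->]] [b [Pb ->]]; exists (fun i => a i + b i); split=> [i|].
    exact: PD.
  by rewrite -big_split; apply: eq_bigr => i _; rewrite rmorphD mulrDl.
have QB x y : Q x -> Q y -> Q (x - y).
  move=> [a [Pa ->]] [b [Pb ->]]; exists (fun i => a i - b i); split=> [i|].
    exact: PB.
  by rewrite -sumrB; apply: eq_bigr => i _; rewrite rmorphB mulrBl.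
have QZ a x : P a -> Q x -> Q (g a * x).
  move=> Pa [b [Pb ->]]; exists (fun i => a * b i); split=> [i|]; first exact: PM.
  by rewrite mulr_sumr; apply: eq_bigr => i _; rewrite rmorphM mulrA.
have Q0 : Q 0.
  by exists (fun=> 0); split=> //; rewrite big1 // => i _; rewrite rmorph0 mul0r.
have QM x y : Q x -> Q y -> Q (x * y).
  move=> [a [Pa ->]] [b [Pb ->]]; rewrite mulr_suml.
  apply: (big_ind Q) => // i _; rewrite mulr_sumr; apply: (big_ind Q) => // l _.
  rewrite -mulrA [e i * _]mulrA -[e i * g _]gC -!mulrA.
  by apply: (QZ) => //; apply: QZ => //; exists (co (e i * e l)).
have Qg c : Q (g (iota c)).
  exists (fun i => if i == ord0 then iota c else 0); split=> [i|].
    by case: ifP.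
  rewrite (bigD1 ord0) //= e0 mulr1 big1 ?addr0 // => i /andP[_ /negPf->].
  by rewrite rmorph0 mul0r.
move=> z; have [||||c [Pc gz]] := gent Q _ _ _ _ (g z) => //.
  by move=> x tx; exists (co x); split=> // i; exact: Pt.
suff -> : z = c ord0 by [].
apply/esym/eqP; rewrite -subr_eq0; apply/eqP.
(* The coefficients of g z - g z e_0 = 0 on the family e. *)
pose c' i := if i == ord0 then c ord0 - z else c i.
have -> : c ord0 - z = c' ord0 by [].
apply: freeB; rewrite (bigD1 ord0) //= /c' eqxx e0 mulr1.
rewrite (eq_bigr (fun i => g (c i) * e i)) => [|i /andP[_ /negPf->]//].
rewrite rmorphB [g z]gz [X in _ - X + _](bigD1 ord0) //= e0 mulr1.
by rewrite opprD addrA subrr add0r addNr.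
Qed.
End ArtinTate.

(** * Residue fields and Nakayama's lemma *)

Section ResidueField.
Variables (Z : nzRingType) (ZC : commutative (@GRing.mul Z)).
Variables (m : set Z) (maxm : maxSpec m).

Let idm : is_ideal m. Proof. by case: maxm. Qed.

(** The quotient ring is classically a field; the inverse is chosen. *)
Definition residue := ideal_quot (Build_ideal idm).

HB.instance Definition _ := GRing.PzRing.on residue.

Let pim : Z -> residue := \pi_residue.

Let pimM x y : pim (x * y) = pim x * pim y.
Proof. exact/esym/quot_mulE. Qed.

Let pim1 : pim 1 = 1. Proof. by []. Qed.

Let pimB x y : pim (x - y) = pim x - pim y.
Proof. exact: pi_is_zmod_morphism. Qed.

Let pimD x y : pim (x + y) = pim x + pim y.
Proof. exact/esym/quot_addE. Qed.

Let pim0 : pim 0 = 0. Proof. by rewrite -(subrr 0) pimB subrr. Qed.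

Let pimP x : pim x = 0 <-> m x.
Proof. by rewrite -pim0 -[X in m X]subr0; exact: ideal_quotP. Qed.

Let pimK (x : residue) : pim (repr x) = x. Proof. exact: reprK. Qed.

Let residue_mulC : commutative (@GRing.mul residue).
Proof. by move=> x y; rewrite -(pimK x) -(pimK y) -!pimM ZC. Qed.

Let residue_1 : (1 : residue) != 0.
Proof. by apply/eqP; rewrite -pim1 => /pimP; case: maxm. Qed.

Let residue_inv (x : residue) : exists y, (x != 0 -> y * x = 1) /\ (x = 0 -> y = 0).
Proof.
have [->|nzx] := eqVneq x 0; first by exists 0.
pose J : set Z := [set z | exists a b, m a /\ z = a + b * repr x].
case: (maxm) => [[m0 mD mMl mMr] _ /(_ J)].
case=> [|z mz|Jm|JT].
- split=> [|_ _ [a [b [ma ->]]] [c [d [mc ->]]]|c _ [a [b [ma ->]]]|_ c [a [b [ma ->]]]].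
  + by exists 0, 0; rewrite mul0r addr0.
  + by exists (a + c), (b + d); rewrite mulrDl addrACA; split; first exact: mD.
  + by exists (c * a), (c * b); rewrite mulrDr mulrA; split; first exact: mMl.
  + exists (a * c), (b * c); split; first exact: mMr.
    by rewrite mulrDl -!mulrA [repr x * c]ZC.
- by exists z, 0; rewrite mul0r addr0.
- case/eqP: nzx; rewrite -[x]pimK; apply/pimP.
  have : J (repr x) by exists 0, 1; rewrite mul1r add0r.
  by rewrite Jm.
have [a [b [ma e1]]] : J 1 by rewrite JT.
exists (pim b); split=> [_|x0]; last by rewrite x0 eqxx in nzx.
by rewrite -[x in LHS]pimK -pimM -pim1 e1 -[LHS]add0r -(iffRL (pimP a) ma) -pimD.
Qed.

Let inv := projT1 (choice residue_inv).

Let mulVr x : x != 0 -> inv x * x = 1.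
Proof. by move=> x0; have [+ _] := projT2 (choice residue_inv) x; apply. Qed.

Let invr0 : inv 0 = 0.
Proof. by have [_] := projT2 (choice residue_inv) 0; apply. Qed.

HB.instance Definition _ := GRing.PzSemiRing_isNonZero.Build residue residue_1.
HB.instance Definition _ := GRing.PzRing_hasCommutativeMul.Build residue residue_mulC.
HB.instance Definition _ := GRing.ComNzRing_isField.Build residue mulVr invr0.

Lemma residue_field : exists (K : fieldType) (pi : {rmorphism Z -> K}),
  (forall y, exists x, pi x = y) /\ forall x, pi x = 0 <-> m x.
Proof.
have [||pi piE] := @rmorphism_of Z residue pim; first exact: pimB.
  by split=> // x y; exact: pimM.
exists residue, pi; split=> [y|x]; last by rewrite piE.
by exists (repr y); rewrite piE.
Qed.

End ResidueField.

Section Nakayama.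
Variables (Z K : comNzRingType) (pi : {rmorphism Z -> K}).
Variables (A : nzRingType) (f : {rmorphism Z -> A}).
Hypothesis f_inj : injective f.

(** If 1 lies in mA, where m is the kernel of pi, then the generators s_i satisfy
s = M' s with M' over m. With M = 1 - M' the adjugate shows that det M kills all
s_i, hence A; as f is injective det M = 0, while det M is 1 modulo m. *)
Lemma nakayama (N : nat) (s : 'I_N -> A) (t : seq (Z * A)) :
    (forall a, exists c, a = \sum_i f (c i) * s i) ->
    (forall p, p \in t -> pi p.1 = 0) ->
  \sum_(p <- t) f p.1 * p.2 <> 1.
Proof.
move=> span pit t1; have [co coE] := choice span.
pose M := 1%:M - \matrix_(i, l) \sum_(p <- t) p.1 * co (p.2 * s i) l.
have Ms i : \sum_l f (M i l) * s l = 0.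
  transitivity (s i - \sum_l f (\sum_(p <- t) p.1 * co (p.2 * s i) l) * s l).
    rewrite [X in X - _](_ : _ = \sum_l f (1%:M i l) * s l); last first.
      rewrite (bigD1 i) //= mxE eqxx rmorph1 mul1r big1 ?addr0 // => l.
      by rewrite mxE eq_sym => /negPf->; rewrite rmorph0 mul0r.
    by rewrite -sumrB; apply: eq_bigr => l _; rewrite !mxE rmorphB mulrBl.
  rewrite -[X in X - _]mul1r -t1 mulr_suml; apply/eqP; rewrite subr_eq0; apply/eqP.
  under [RHS]eq_bigr do rewrite rmorph_sum mulr_suml.
  rewrite exchange_big; apply: eq_bigr => p _ /=.
  rewrite -mulrA [p.2 * s i]coE mulr_sumr; apply: eq_bigr => l _.
  by rewrite -coE rmorphM mulrA.
have dets l : f (\det M) * s l = 0.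
  transitivity (\sum_i f (\adj M l i) * \sum_r f (M i r) * s r); last first.
    by rewrite big1 // => i _; rewrite Ms mulr0.
  under eq_bigr do rewrite mulr_sumr.
  rewrite exchange_big /= (bigD1 l) //= [X in _ + X]big1 => [|r /negPf nrl].
    rewrite addr0; under eq_bigr do rewrite mulrA -rmorphM.
    rewrite -mulr_suml -rmorph_sum; congr (f _ * _).
    by have /matrixP/(_ l l) := mul_adj_mx M; rewrite !mxE eqxx.
  under eq_bigr do rewrite mulrA -rmorphM.
  rewrite -mulr_suml -rmorph_sum.
  have /matrixP/(_ l r) := mul_adj_mx M; rewrite !mxE eq_sym nrl => ->.
  by rewrite rmorph0 mul0r.
have : pi (\det M) = 1.
  rewrite -det_map_mx -[RHS](det1 K N); congr (\det _); apply/matrixP=> i l.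
  rewrite !mxE rmorphB rmorph_sum rmorph_nat big_seq big1 ?subr0 // => p tp.
  by rewrite rmorphM pit // mul0r.
suff -> : \det M = 0 by rewrite rmorph0 => /esym/eqP; rewrite oner_eq0.
apply: f_inj; rewrite rmorph0 -[LHS]mulr1; have [c ->] := span 1.
by rewrite mulr_sumr big1 // => i _; rewrite mulrA -rmorphM mulrC rmorphM -mulrA dets mulr0.
Qed.
End Nakayama.

(** * Characters and maximal ideals *)

Section Characters.
Variables (k : fieldType) (A : algType k).

Lemma character_of (f : A -> k^o) :
  linear f -> monoid_morphism f -> exists chi : character A, chi =1 f.
Proof.
move=> fL fM.
pose m1 := GRing.isLinear.Build k A k^o *:%R f fL.
pose m2 := GRing.isMonoidMorphism.Build A k^o f fM.
pose g : character A := HB.pack f m1 m2.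
by exists g.
Qed.

Lemma char_alg (chi : character A) (c : k) : chi c%:A = c.
Proof. by rewrite linearZ /= rmorph1; exact: mulr1. Qed.

Lemma char_ker_is_ideal (chi : character A) : is_ideal (char_ker chi).
Proof.
split; rewrite /char_ker /=; first exact: rmorph0.
- by move=> x y cx cy; rewrite rmorphD /= cx cy addr0.
- by move=> a x cx; rewrite rmorphM /= cx mulr0.
- by move=> x a cx; rewrite rmorphM /= cx mul0r.
Qed.

Lemma char_ker_1 (chi : character A) : ~ char_ker chi 1.
Proof. by rewrite /char_ker /= rmorph1 => /eqP; rewrite oner_eq0. Qed.

(** a - chi(a) 1 lies in the kernel of chi. *)
Lemma char_ker_inj (chi psi : character A) :
  char_ker chi `<=` char_ker psi -> chi =1 psi.
Proof.
move=> sub a; have : char_ker psi (a - (chi a)%:A).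
  by apply: sub; rewrite /char_ker /= rmorphB /= char_alg subrr.
by rewrite /char_ker /= rmorphB /= char_alg => /eqP; rewrite subr_eq0 => /eqP.
Qed.

Lemma char_ker_ext (chi psi : character A) : chi =1 psi -> char_ker chi = char_ker psi.
Proof. by move=> e; apply/seteqP; split=> a; rewrite /char_ker /= e. Qed.

(** The kernel has codimension one. *)
Lemma char_ker_max (chi : character A) : maxSpec (char_ker chi).
Proof.
split; [exact: char_ker_is_ideal|exact: char_ker_1|].
move=> J [J0 JD JMl JMr] sub.
have [sJ|] := pselect (J `<=` char_ker chi).
  by left; apply/seteqP.
move=> /existsNP[x /not_implyP[Jx /eqP nzx]]; right; apply/seteqP; split=> // y _.
have -> : y = (y - (chi y / chi x)%:A * x) + (chi y / chi x)%:A * x by rewrite subrK.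
apply: (JD) (JMl _ _ Jx); apply: sub.
rewrite /char_ker /= rmorphB rmorphM /= char_alg; apply/eqP.
by rewrite subr_eq0 -[X in _ == X]mulrA mulVf // mulr1.
Qed.
End Characters.

Lemma ideal_quot_rmorph (A : nzRingType) (J : ideal A) :
  exists q : {rmorphism A -> ideal_quot J}, q =1 \pi_(ideal_quot J).
Proof.
apply: rmorphism_of; first exact: pi_is_zmod_morphism.
by split=> // x y; exact/esym/quot_mulE.
Qed.

(** The Nullstellensatz for C, obtained from finite generation of H rather than
of C: see the introduction. *)
Lemma maxSpec_char_ker (k : closedFieldType) (H : hopfAlgType k)
    (C : centralHopfSubalg H) (m : set C) :
    affine H -> finite_over C -> maxSpec m ->
  exists phi : character C, m = char_ker phi.
Proof.
move=> [t gent] [s spans] maxm.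
have CC : commutative (@GRing.mul C).
  by move=> x y; apply: (@incl_inj _ _ C); rewrite !rmorphM /= incl_central.
have [K [pi [pi_surj piP]]] := residue_field CC maxm.
(* C is commutative as it is central in H; determinants require this to be
   part of the structure. *)
pose Z : comNzRingType :=
  HB.pack (hsub_sort C) (GRing.PzRing_hasCommutativeMul.Build C CC).
pose f : {rmorphism Z -> H} := @Defs.incl _ _ C.
pose piZ : {rmorphism Z -> K} := pi.
have [q qE] := ideal_quot_rmorph (ext_ideal m).
have qP h : q h = 0 <-> ext_set m h.
  by rewrite -(rmorph0 q) !qE -[X in ext_set m X]subr0; exact: ideal_quotP.
have D1 : (1 : ideal_quot (ext_ideal m)) != 0.
  rewrite -(rmorph1 q); apply/eqP => /qP[r mr e1].
  apply: (@nakayama Z K piZ H f (@incl_inj _ _ C) _ (fun i : 'I_(size s) => s`_i) r).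
  - by move=> h; have [c ->] := spans h; exists c.
  - by move=> p /mr /piP.
  - by rewrite e1.
have qincl c d : pi c = pi d -> q (Defs.incl c) = q (Defs.incl d).
  move=> e; apply/eqP; rewrite -subr_eq0 -rmorphB -rmorphB; apply/eqP/qP.
  exists [:: (c - d, 1)]; last by rewrite big_seq1 mulr1.
  by move=> p; rewrite inE => /eqP->; apply/piP; rewrite rmorphB /= e subrr.
have [sec secK] := choice pi_surj.
have [||g gE] := @rmorphism_of K _ (fun y => q (Defs.incl (sec y))).
- by move=> x y; rewrite -!rmorphB; apply: qincl; rewrite rmorphB !secK.
- split=> [|x y]; first by rewrite -(rmorph1 q) -(rmorph1 (@Defs.incl _ _ C)); apply: qincl;
    rewrite rmorph1 secK.
  by rewrite -!rmorphM; apply: qincl; rewrite rmorphM !secK.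
have gpi c : g (pi c) = q (Defs.incl c) by rewrite gE; apply: qincl; rewrite secK.
have gC y x : g y * x = x * g y.
  have [c <-] := pi_surj y; rewrite gpi.
  by rewrite -[x]reprK -qE -!rmorphM incl_central.
pose iota : {rmorphism k -> K} := pi \o in_alg C.
have [||l genl] := artin_tate (iota := iota) gC D1 (t := map q t)
  (d := fun i : 'I_(size s) => q s`_i).
- move=> x; have [c e] := spans (repr x); exists (pi \o c).
  rewrite -[x]reprK -qE e rmorph_sum; apply: eq_bigr => i _.
  by rewrite /= gpi rmorphM.
- move=> P Pk PB PM Pt x; rewrite -[x]reprK -qE; move: (repr x) => h.
  pose Q : {pred H} := fun h => `[< P (q h) >].
  suff /asboolP : h \in Q by [].
  have Pa c : P (q c%:A).
    by have := Pk c; rewrite /= gpi -in_algE rmorph_alg.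
  have P0 : P 0 by rewrite -(rmorph0 q) -(scale0r 1); exact: Pa.
  apply: gent => [|z tz]; last by apply/asboolP/Pt; rewrite map_f.
  split; first by apply/asboolP; have := Pa 1; rewrite scale1r.
    move=> a u v /asboolP Pu /asboolP Pv; apply/asboolP.
    rewrite -[v]opprK -[- v]sub0r rmorphB /= rmorphB rmorph0 -mulr_algl rmorphM.
    by apply: (PB); [apply: PM|exact: PB].
  by move=> u v /asboolP Pu /asboolP Pv; apply/asboolP; rewrite rmorphM; exact: PM.
have [psi psiK] := finite_type_retraction genl.
have [||phi phiE] := @character_of k C (psi \o pi).
- move=> a x y; rewrite /= -mulr_algl !rmorphD !rmorphM /=; congr (_ * _ + _).
  exact: psiK.
- by split=> [|x y]; rewrite /= ?rmorph1 ?rmorphM.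
exists phi; case: maxm => _ _ maxm.
have [|//|kT] := maxm _ (char_ker_is_ideal phi).
  by move=> c /piP pc; rewrite /char_ker /= phiE /= pc rmorph0.
by case: (@char_ker_1 _ _ phi); rewrite kT.
Qed.

(** * Winding maps and the group of characters *)

Lemma linear_of (k : fieldType) (U V : lmodType k) (f : U -> V) :
  linear f -> exists g : {linear U -> V}, g =1 f.
Proof.
move=> fL; pose g : {linear U -> V} :=
  HB.pack f (GRing.isLinear.Build k U V *:%R f fL).
by exists g.
Qed.

Lemma tsum_sum (k : fieldType) (V W U : lmodType k) (f : V -> W -> U) :
    bilinear_map f -> forall (I : Type) (r : seq I) (x : I -> tensor V W),
  tsum f (\sum_(i <- r) x i) = \sum_(i <- r) tsum f (x i).
Proof.
move=> fB I r x; have [g gE] := linear_of (tsum_linear fB).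
by rewrite -gE linear_sum; apply: eq_bigr => i _; rewrite gE.
Qed.

Section HopfWinding.
Variables (k : fieldType) (A : hopfAlgType k).
Implicit Types (chi psi : {linear A -> k^o}) (g h : A).

(** Right winding by a linear functional. Convolution inverses of characters
enter first as linear functionals, before they are known to be multiplicative. *)
Definition wind chi h : A := tsum (fun a b => (chi b : k) *: a) (comul h).

Lemma functionalP chi c g h : chi (c *: g + h) = c * (chi g : k) + chi h.
Proof. exact: linearP. Qed.

Lemma functionalZ chi c h : chi (c *: h) = c * (chi h : k).
Proof. exact: linearZ. Qed.

Lemma wind_bilinear chi : bilinear_map (fun a b : A => (chi b : k) *: a : A).
Proof.
split=> [b c a a'|a c b b'] /=; first by rewrite scalerDr !scalerA mulrC.
by rewrite linearP scalerDl scalerA.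
Qed.

Lemma wind_is_linear chi : linear (wind chi).
Proof.
by move=> c a b; rewrite /wind linearP; exact: (tsum_linear (wind_bilinear chi)).
Qed.

HB.instance Definition _ chi :=
  GRing.isLinear.Build k A A *:%R (wind chi) (wind_is_linear chi).

(** Coassociativity in the form used in Sweedler calculus: trilinear expressions
in h_(1), h_(2), h_(3) do not depend on the bracketing. *)
Lemma coassoc (U : lmodType k) (f : A -> A -> A -> U) h :
    (forall c, bilinear_map (fun a b => f a b c)) -> (forall a b, linear (f a b)) ->
  tsum (fun a c => tsum (fun a1 a2 => f a1 a2 c) (comul a)) (comul h) =
  tsum (fun a b => tsum (fun b1 b2 => f a b1 b2) (comul b)) (comul h).
Proof.
move=> fB fL; pose F (x : tensor A A) (c : A) := tsum (fun a b => f a b c) x.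
have FB : bilinear_map F.
  split=> [c|x d c c']; first exact: tsum_linear (fB c).
  by rewrite /F /tsum scaler_sumr -big_split; apply: eq_bigr => p _; rewrite fL.
have FE a b c : tsum F (a ⊗ b ⊗ c) = f a b c.
  by rewrite (tsum_tens FB) /F (tsum_tens (fB c)).
have := congr1 (tsum F) (comulA h).
rewrite [X in tsum F X]/tsum (tsum_sum FB) [X in _ = tsum F X]/tsum (tsum_sum FB).
move=> e; transitivity (\sum_(p <- repr (comul h))
    tsum F (tsum (fun a1 a2 => a1 ⊗ a2 ⊗ p.2) (comul p.1))).
  apply: eq_bigr => p _; rewrite [X in tsum F X]/tsum (tsum_sum FB).
  by apply: eq_bigr => q _; rewrite FE.
rewrite {}e; apply: eq_bigr => p _; rewrite [X in tsum F X]/tsum (tsum_sum FB).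
by apply: eq_bigr => q _; rewrite FE.
Qed.

(** The functional on the right is the convolution of chi and psi, so winding is
a monoid homomorphism from functionals to linear maps. *)
Lemma wind_comp chi psi h :
  wind chi (wind psi h) = wind (chi \o wind psi) h.
Proof.
have -> : wind chi (wind psi h) =
    tsum (fun a c =>
      tsum (fun a1 a2 => (psi c : k) *: ((chi a2 : k) *: a1) : A) (comul a))
      (comul h).
  rewrite {2}/wind linear_sum; apply: eq_bigr => p _.
  by rewrite linearZ /= /wind /tsum scaler_sumr.
rewrite (@coassoc _ (fun a b c => (psi c : k) *: ((chi b : k) *: a) : A)); first last.
- by move=> a b d c c' /=; rewrite functionalP scalerDl !scalerA mulrA.
- move=> c; split=> [b d a a'|a d b b'] /=.
    by rewrite !scalerDr !scalerA; congr (_ *: _ + _); rewrite mulrC mulrA.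
  by rewrite functionalP scalerDl scalerDr !scalerA; congr (_ *: _ + _); rewrite mulrCA.
apply: eq_bigr => p _; rewrite /= /wind linear_sum scaler_suml.
by apply: eq_bigr => q _; rewrite functionalZ scalerA.
Qed.

Lemma wind_counit h : wind counit h = h.
Proof. exact: counitr. Qed.

(** A functional is recovered from its winding map; identities between
functionals can thus be proved for winding maps. *)
Lemma counit_wind chi h : counit (wind chi h) = chi h.
Proof.
rewrite -[h in RHS]counitl /wind !linear_sum; apply: eq_bigr => p _.
by rewrite !linearZ; exact: mulrC.
Qed.

Lemma wind1 (chi : character A) : wind chi 1 = 1.
Proof. by rewrite /wind comul1 (tsum_tens (wind_bilinear chi)) rmorph1 scale1r. Qed.

Lemma windM (chi : character A) g h : wind chi (g * h) = wind chi g * wind chi h.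
Proof.
rewrite {1}/wind comulM /tensor_mul [X in tsum _ X]/tsum (tsum_sum (wind_bilinear chi)).
rewrite [in RHS]/wind [in RHS]/tsum mulr_suml; apply: eq_bigr => p _.
rewrite (tsum_sum (wind_bilinear chi)) mulr_sumr; apply: eq_bigr => q _.
by rewrite (tsum_tens (wind_bilinear chi)) rmorphM -scalerAl -scalerAr scalerA.
Qed.

Lemma char_wind_antipode (chi : character A) h :
  chi (wind (chi \o antipode) h) = counit h.
Proof.
rewrite -[RHS](char_alg chi) -antipoder !linear_sum; apply: eq_bigr => p _.
by rewrite linearZ rmorphM; exact: mulrC.
Qed.

Lemma char_antipode_wind (chi : character A) h :
  chi (antipode (wind chi h)) = counit h.
Proof.
rewrite -[RHS](char_alg chi) -antipodel !linear_sum; apply: eq_bigr => p _.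
by rewrite !linearZ rmorphM; exact: mulrC.
Qed.

Lemma eq_wind chi psi : chi =1 psi -> wind chi =1 wind psi.
Proof. by move=> e h; apply: eq_bigr => p _; rewrite e. Qed.

Lemma wind_antipodeK (chi : character A) : cancel (wind (chi \o antipode)) (wind chi).
Proof.
move=> h; rewrite wind_comp -[RHS]wind_counit; apply: eq_wind => a.
exact: char_wind_antipode.
Qed.

Lemma antipode_windK (chi : character A) : cancel (wind chi) (wind (chi \o antipode)).
Proof.
move=> h; rewrite wind_comp -[RHS]wind_counit; apply: eq_wind => a.
exact: char_antipode_wind.
Qed.

(** The convolution inverse of chi is chi o S. That it is multiplicative follows
without knowing that S reverses products: the winding map of chi o S is inverse
to the multiplicative map wind chi, hence multiplicative, and composing it with
the counit gives chi o S. *)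
Lemma char_inv (chi : character A) : exists chi' : character A,
  cancel (wind chi) (wind chi') /\ cancel (wind chi') (wind chi).
Proof.
have S_wind h : chi (antipode h) = counit (wind (chi \o antipode) h).
  by rewrite counit_wind.
have W1 : wind (chi \o antipode) 1 = 1 by rewrite -[in LHS](wind1 chi) antipode_windK.
have WM g h : wind (chi \o antipode) (g * h) =
    wind (chi \o antipode) g * wind (chi \o antipode) h.
  apply: (can_inj (antipode_windK chi)).
  by rewrite windM !wind_antipodeK.
have [||chi' chi'E] := @character_of _ A (chi \o antipode); first exact: linearP.
  by split=> [|g h]; rewrite /= !S_wind ?W1 ?WM ?rmorph1 ?rmorphM.
have W'E : wind chi' =1 wind (chi \o antipode) by exact: eq_wind.
exists chi'; split=> h; rewrite W'E; first exact: antipode_windK.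
exact: wind_antipodeK.
Qed.

Lemma convE (chi psi : character A) h : conv chi psi h = chi (wind psi h).
Proof.
by rewrite linear_sum; apply: eq_bigr => p _; rewrite linearZ; exact: mulrC.
Qed.

Lemma conv_char (chi psi : character A) :
  exists theta : character A, theta =1 conv chi psi.
Proof.
apply: character_of => [c a b|]; first by rewrite !convE !linearP.
by split=> [|a b]; rewrite !convE ?wind1 ?windM ?rmorph1 ?rmorphM.
Qed.

(** The characters in the definition of [mconv] are determined by their
kernels. *)
Lemma mconv_char_ker (chi psi theta : character A) :
  theta =1 conv chi psi -> mconv (char_ker chi) (char_ker psi) = char_ker theta.
Proof.
move=> e; apply/seteqP; split=> h; last first.
  by move=> h0; exists chi, psi; split=> //; rewrite -e.
move=> [chi' [psi' [e1 e2 e3]]]; suff: theta h = 0 by [].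
rewrite -e3 e !convE.
have /char_ker_inj-> : char_ker chi `<=` char_ker chi' by rewrite e1.
congr (chi' _); apply: eq_wind.
by apply: char_ker_inj; rewrite e2.
Qed.
End HopfWinding.

(** * Restriction of characters to a central Hopf subalgebra *)

Section CentralSubalgebra.
Variables (k : fieldType) (H : hopfAlgType k) (C : centralHopfSubalg H).

Definition res_char (chi : character H) : character C := chi \o @Defs.incl _ _ C.

Lemma wind_incl (chi : character H) (c : C) :
  wind chi (Defs.incl c) = Defs.incl (wind (res_char chi) c).
Proof.
rewrite /wind incl_comul [X in tsum _ X]/tsum (tsum_sum (wind_bilinear chi)).
rewrite linear_sum; apply: eq_bigr => p _.
by rewrite (tsum_tens (wind_bilinear chi)) linearZ.
Qed.

Lemma res_conv (chi psi theta : character H) :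
  theta =1 conv chi psi -> res_char theta =1 conv (res_char chi) (res_char psi).
Proof. by move=> e c; rewrite convE /= -wind_incl e convE. Qed.

Lemma res_char_counit (chi : character H) :
  chi =1 counit -> char_ker (res_char chi) = char_ker (@counit k C).
Proof. by move=> e; apply: char_ker_ext => c; rewrite /= e incl_counit. Qed.

Lemma conv_inv (chi chi' : character H) :
  cancel (wind chi') (wind chi) -> conv chi chi' =1 counit.
Proof. by move=> K h; rewrite convE -counit_wind K. Qed.

(** c lies in the image of Ker phi under wind chi iff phi kills the preimage
wind chi' c, and phi (wind chi' c) is the value at c of phi * chi'. *)
Lemma restr_act_wind (phi : character C) (chi chi' : character H) :
    cancel (wind chi) (wind chi') -> cancel (wind chi') (wind chi) ->
  restr_act (winding_r chi) (char_ker phi) =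
  mconv (char_ker phi) (char_ker (res_char chi')).
Proof.
move=> chiK chi'K; have [theta thetaE] := conv_char phi (res_char chi').
rewrite (mconv_char_ker thetaE); apply/seteqP; split=> [c [d phid e]|c tc].
  suff: theta c = 0 by []; rewrite thetaE convE.
  suff -> : wind (res_char chi') c = d by [].
  by apply: (@incl_inj _ _ C); rewrite -wind_incl e; exact: chiK.
exists (wind (res_char chi') c); last by rewrite -wind_incl; exact/esym/chi'K.
by move: tc; rewrite /char_ker /= thetaE convE.
Qed.

Section Dim1.
Variables (chi : character H) (m : set C).
Hypothesis mchi : m `<=` char_ker (res_char chi).

Let B := ideal_quot (ext_ideal m).

(** A copy of k, to carry the action of H/mH through chi. *)
Definition char_module : Type := k.
HB.instance Definition _ := GRing.Zmodule.on char_module.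

Let act (x : B) (a : char_module) : char_module := (chi (repr x) : k) * a.

Let chi_repr h : chi (repr (\pi_B h)) = chi h.
Proof.
have /ideal_quotP[s ms e] : \pi_B (repr (\pi_B h)) = \pi_B h by rewrite reprK.
apply/eqP; rewrite -subr_eq0 -rmorphB /= e rmorph_sum big_seq big1 // => p sp.
have /mchi := ms _ sp; rewrite /char_ker /= => chi0.
by rewrite rmorphM /= chi0 mul0r.
Qed.

Let actA x y a : act x (act y a) = act (x * y) a.
Proof. by rewrite /act /= mulrA -[x * y]/(\pi_B _) chi_repr rmorphM. Qed.

Let act1 : left_id 1 act.
Proof. by move=> a; rewrite /act -[1]/(\pi_B 1) chi_repr rmorph1 mul1r. Qed.

Let actDr : right_distributive act +%R.
Proof. by move=> x a b; exact: mulrDr. Qed.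

Let actDl a : {morph act^~ a : x y / x + y}.
Proof.
move=> x y; rewrite /act -mulrDl -[x in LHS]reprK -[y in LHS]reprK quot_addE chi_repr.
by rewrite rmorphD.
Qed.

Let mixin := GRing.Zmodule_isLmodule.Build B char_module actA act1 actDr actDl.

Lemma char_dim1_module : has_dim1_module m.
Proof.
pose M : lmodType B := HB.pack char_module mixin.
exists M, (1 : k); split; first exact: oner_neq0.
move=> w; exists (w : k); rewrite -[RHS]/(act _ _) /act chi_repr char_alg.
by rewrite mulr1.
Qed.
End Dim1.

(** chi(h) is the eigenvalue of h on v. *)
Lemma dim1_module_char (m : set C) : has_dim1_module m ->
  exists chi : character H, m `<=` char_ker (res_char chi).
Proof.
move=> [M [v [vnz gen]]].
have [q qE] := ideal_quot_rmorph (ext_ideal m).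
have [r rE] : exists r : {rmorphism k -> ideal_quot (ext_ideal m)},
  forall c, r c = q c%:A by exists (q \o in_alg H).
have qZ c h : q (c *: h) = r c * q h by rewrite -mulr_algl rmorphM rE.
have rC c h : q h * r c = r c * q h by rewrite rE -rmorphM mulr_algr qZ rE.
have eigen h : exists c, q h *: v = r c *: v.
  by have [c e] := gen (q h *: v); exists c; rewrite e rE qE.
have [chi chiE] := choice eigen.
have r_inj c : r c *: v = 0 -> c = 0.
  move=> cv; apply: contrapT => /eqP cnz; case/eqP: vnz.
  by rewrite -[v]scale1r -(rmorph1 r) -(mulVf cnz) rmorphM -scalerA cv scaler0.
have chi_uniq h c : q h *: v = r c *: v -> chi h = c.
  rewrite chiE => e; apply/eqP; rewrite -subr_eq0; apply/eqP/r_inj.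
  by rewrite rmorphB scalerBl e subrr.
have [||psi psiE] := @character_of k H chi.
- move=> c x y; apply: (chi_uniq (c *: x + y) (c * chi x + chi y)).
  by rewrite !rmorphD qZ !scalerDl rmorphM -!scalerA !chiE.
- split=> [|x y]; first by apply: (chi_uniq 1 1); rewrite !rmorph1.
  apply: (chi_uniq (x * y) (chi x * chi y)).
  by rewrite mulrC !rmorphM -!scalerA chiE scalerA rC -scalerA chiE.
exists psi => c mc; suff: psi (Defs.incl c) = 0 by [].
rewrite psiE; apply: chi_uniq; rewrite rmorph0; congr (_ *: _).
rewrite qE -(rmorph0 q) qE; apply/ideal_quotP; rewrite subr0.
by exists [:: (c, 1)]; [move=> p; rewrite inE => /eqP->|rewrite big_seq1 mulr1].
Qed.

Lemma dim1_locusP (m : set C) :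
  dim1_locus C m <-> exists chi, m = char_ker (res_char chi).
Proof.
split=> [[maxm /dim1_module_char[chi sub]]|[chi ->]].
  exists chi; case: maxm => _ _ maxm.
  have [//|//|kT] := maxm _ (char_ker_is_ideal (res_char chi)).
  by case: (@char_ker_1 _ _ (res_char chi)); rewrite kT.
split; first exact: char_ker_max.
exact: (@char_dim1_module chi _ (fun=> id)).
Qed.

Lemma dim1_locus_subgroup : conv_subgroup (dim1_locus C).
Proof.
split=> [m []//||m n /dim1_locusP[chi ->] /dim1_locusP[psi ->]|m /dim1_locusP[chi ->]].
- by apply/dim1_locusP; exists counit; rewrite res_char_counit.
- have [theta e] := conv_char chi psi; apply/dim1_locusP; exists theta.
  exact: mconv_char_ker (res_conv e).
have [chi' [chiK chi'K]] := char_inv chi.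
exists (char_ker (res_char chi')); first by apply/dim1_locusP; exists chi'.
have [theta e] := conv_char chi chi'; have [theta' e'] := conv_char chi' chi.
rewrite (mconv_char_ker (res_conv e)) (mconv_char_ker (res_conv e')).
by split; apply: res_char_counit => h; rewrite ?e ?e'; exact: conv_inv.
Qed.
End CentralSubalgebra.

(** * Cosets and orbits *)

Theorem theorem2p14 (k : closedFieldType) (H : hopfAlgType k)
    (C : centralHopfSubalg H) (affH : affine H) (finH : finite_over C) :
  conv_subgroup (dim1_locus C) /\
  forall m : set C, maxSpec m ->
    left_coset m (dim1_locus C) = orbit_of (winding_r_group H) m.
Proof.
split=> [|m maxm]; first exact: dim1_locus_subgroup.
have [phi ->] := maxSpec_char_ker affH finH maxm.
apply/seteqP; split=> [_ [_ /dim1_locusP[chi ->] <-]|_ [_ [chi _ <-] <-]];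
  have [chi' [chiK chi'K]] := char_inv chi.
  exists (winding_r chi'); first by exists chi'.
  exact: restr_act_wind.
exists (char_ker (res_char C chi')); first by apply/dim1_locusP; exists chi'.
exact/esym/restr_act_wind.
Qed.
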